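(* Let $X$ and $Y$ be compact spaces and let $Y$ be scattered. (1) If $X$ is Eberlein compact, then a semi-embedding $T:C_p(X)\to C_p(Y)$ is an embedding if and only if $X$ is scattered. (2) If $X$ is infinite and scattered, then there exists a continuous linear injective surjection $T:C_p(X)\to C_p(X)$ which is not open. In particular, if additionally $X$ is Eberlein compact, then this $T$ is not a semi-embedding.
   Context: Compact spaces are Hausdorff. A space is scattered if every non-empty subspace of it has an isolated point. $C_p(X)$ denotes the vector space of continuous real-valued functions on $X$ endowed with the topology of pointwise convergence. A compact space is Eberlein compact if it is homeomorphic to a weakly compact subset of a Banach space. Let $E,F$ be locally convex spaces and $T:E\to F$ a continuous linear map. $T$ is polar if there exists in $E$ a base $\mathcal{U}$ of closed neighbourhoods of zero such that $T(U)$ is closed in $F$ for each $U\in\mathcal{U}$. $T$ is a semi-embedding if it is polar and injective. $T$ is an embedding if it is an isomorphism (linear homeomorphism) onto its range $T(E)$ with the topology inherited from $F$. *)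

(* Defs.v *)
From HB Require Import structures.
From mathcomp Require Import all_boot all_order all_algebra.
From mathcomp Require Import all_classical all_reals all_analysis.
From mathcomp Require Import lra.
Import Order.TTheory GRing.Theory Num.Theory.
Import numFieldNormedType.Exports.

Set Implicit Arguments.
Unset Strict Implicit.
Unset Printing Implicit Defensive.

Local Open Scope classical_set_scope.
Local Open Scope ring_scope.

Definition scattered (X : topologicalType) : Prop :=
  forall A : set X, A !=set0 -> isolated A !=set0.

Definition homeomorphic (X Y : topologicalType) : Prop :=
  exists (f : X -> Y) (g : Y -> X),
    [/\ cancel f g, cancel g f, continuous f & continuous g].

Definition topological_dual (R : realType) (E : normedModType R) : Type :=
  {phi : {linear E -> R^o} | continuous phi}.

Definition dual_pairing (R : realType) (E : normedModType R) (v : E) :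
    {ptws topological_dual E -> R} :=
  fun phi => sval phi v.

(* The weak topology: the coarsest one making every element of the topological
   dual continuous. *)
Definition weak_space (R : realType) (E : normedModType R) : topologicalType :=
  initial_topology (@dual_pairing R E).

(* Meant for a compact Hausdorff X. K is compact for the weak topology, and
   set_type K carries the topology induced by the weak one. *)
Definition eberlein (R : realType) (X : topologicalType) : Prop :=
  exists (E : completeNormedModType R) (K : set (weak_space E)),
    compact K /\ homeomorphic X (set_type K).

Section Cp.
Context (R : realType) (X : topologicalType).

(* Continuous functions, made into a locally convex space with the topology of
   pointwise convergence. *)
Definition Cp : Type := continuousType X R.

HB.instance Definition _ := Choice.copy Cp (continuousType X R).

Implicit Types f g h : Cp.

Lemma Cp_continuous f : continuous f.
Proof. exact: (@cts_fun _ _ (f : continuousType X R)). Qed.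

Lemma CpP f g : f =1 g -> f = g.
Proof. by move=> fg; apply/continuousEP. Qed.

Let opp_continuous f : continuous (fun x => - f x).
Proof. by move=> x; apply: (@cvgN R R); exact: Cp_continuous. Qed.

Let add_continuous f g : continuous (fun x => f x + g x).
Proof. by move=> x; apply: (@cvgD R R); exact: Cp_continuous. Qed.

Let scale_continuous (a : R) f : continuous (fun x => a * f x).
Proof. by move=> x; apply: (@cvgM R X); [exact: cvg_cst|exact: Cp_continuous]. Qed.

Definition Cp_zero : Cp := (cst (0 : R) : continuousType X R).
Definition Cp_opp f : Cp :=
  (mkcts (@opp_continuous f) : continuousType X R).
Definition Cp_add f g : Cp :=
  (mkcts (@add_continuous f g) : continuousType X R).
Definition Cp_scale a f : Cp :=
  (mkcts (@scale_continuous a f) : continuousType X R).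

Let addA : associative Cp_add.
Proof. by move=> f g h; apply: CpP => x; exact: addrA. Qed.

Let addC : commutative Cp_add.
Proof. by move=> f g; apply: CpP => x; exact: addrC. Qed.

Let add0 : left_id Cp_zero Cp_add.
Proof. by move=> f; apply: CpP => x; exact: add0r. Qed.

Let addN : left_inverse Cp_zero Cp_opp Cp_add.
Proof. by move=> f; apply: CpP => x; exact: addNr. Qed.

HB.instance Definition _ := GRing.isZmodule.Build Cp addA addC add0 addN.

Let scaleA a b f : Cp_scale a (Cp_scale b f) = Cp_scale (a * b) f.
Proof. by apply: CpP => x; exact: mulrA. Qed.

Let scale1 : left_id 1 Cp_scale.
Proof. by move=> f; apply: CpP => x; exact: mul1r. Qed.

Let scaleDr : right_distributive Cp_scale +%R.
Proof. by move=> a f g; apply: CpP => x; exact: mulrDr. Qed.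

Let scaleDl f : {morph Cp_scale^~ f : a b / a + b}.
Proof. by move=> a b; apply: CpP => x; exact: mulrDl. Qed.

HB.instance Definition _ :=
  GRing.Zmodule_isLmodule.Build R Cp scaleA scale1 scaleDr scaleDl.

Definition Cp_fun f : {ptws X -> R} := f.

HB.instance Definition _ := Uniform.copy Cp (initial_topology Cp_fun).

Lemma CpDE f g x : (f + g) x = f x + g x. Proof. by []. Qed.

Lemma CpZE a f x : (a *: f) x = a * f x. Proof. by []. Qed.

Lemma Cp_cvgP (F : set_system Cp) f : Filter F ->
  F --> f <-> forall x, g x @[g --> F] --> f x.
Proof.
move=> FF; split=> [Ff x|Ff].
  have /pointwise_cvgP/(_ x) : {ptws, Cp_fun @ F --> Cp_fun f}.
    exact: cvg_comp Ff (@initial_continuous _ _ Cp_fun f).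
  by [].
move=> A [_ [[B oB <-] Bf]] /filterS; apply.
have /(_ B) : {ptws, Cp_fun @ F --> Cp_fun f} by apply/pointwise_cvgP.
by apply; exact: open_nbhs_nbhs.
Qed.

Lemma Cp_eval_continuous x : continuous (fun f : Cp => f x : R).
Proof. move=> f; exact: (iffLR (@Cp_cvgP (nbhs f) f _) (@cvg_id _ _) x). Qed.

Let eval1 x : continuous (fun z : Cp * Cp => z.1 x : R).
Proof.
move=> z; apply: (@continuous_comp _ _ _ fst (fun h : Cp => h x : R)).
  exact: cvg_fst.
exact: Cp_eval_continuous.
Qed.

Let eval2 (T : topologicalType) x : continuous (fun z : T * Cp => z.2 x : R).
Proof.
move=> z; apply: (@continuous_comp _ _ _ snd (fun h : Cp => h x : R)).
  exact: cvg_snd.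
exact: Cp_eval_continuous.
Qed.

Let add_cts : continuous (fun z : Cp * Cp => z.1 + z.2).
Proof.
move=> [f g]; apply/Cp_cvgP => x /=.
apply: (@cvgD R R _ (nbhs (f, g)) _ (fun z : Cp * Cp => z.1 x)
          (fun z => z.2 x)).
- exact: (@eval1 x (f, g)).
- exact: (@eval2 _ x (f, g)).
Qed.

Let scale_cts : continuous (fun z : R^o * Cp => z.1 *: z.2).
Proof.
move=> [a f]; apply/Cp_cvgP => x /=.
apply: (@cvgM R _ (nbhs (a, f)) _ (fun z : R^o * Cp => z.1)
          (fun z => z.2 x)).
- exact: cvg_fst.
- exact: (@eval2 _ x (a, f)).
Qed.

Let locally_convex : exists2 B : set_system Cp,
  (forall b, b \in B -> convex_set b) & basis B.
Proof.
pose B : set_system Cp := [set b | convex_set b /\ open b].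
exists B; first by move=> b; rewrite inE => -[].
split=> [b [] //|f].
pose G : set_system Cp := filter_from [set b | B b /\ b f] id.
have FG : Filter G.
  apply: filter_from_filter => [|b c [[cb ob] bf] [[cc oc] cf]].
    by exists setT; split=> //; split; [by move=> *; rewrite inE|exact: openT].
  exists (b `&` c) => //; split=> //; split; last exact: openI.
  move=> u v l; rewrite !inE => -[bu gu] [bv gv].
  by split; apply/set_mem; [apply: cb|apply: cc]; rewrite inE.
suff Gf : G --> f by move=> A /Gf [b [Bb bf] bA]; exists b.
apply/Cp_cvgP => x; apply/cvgrPdist_lt => e e0.
exists [set g : Cp | `|f x - g x| < e] => //.
split; last by rewrite /= subrr normr0.
split; last first.
  apply: (@open_comp _ _ (fun g : Cp => `|f x - g x|) [set y | y < e]).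
    move=> g _; apply: (@cvg_norm R R _ (nbhs g) _ (fun h : Cp => f x - h x)).
    apply: (@cvgB R R _ (nbhs g) _ (fun=> f x) (fun h : Cp => h x)).
      exact: cvg_cst.
    exact: Cp_eval_continuous.
  exact: open_lt.
apply/convex_setW => u v; rewrite !inE /= => fu fv l l0 l1.
rewrite inE/= CpDE !CpZE /unstable.onem; move: l%:num l0 l1 => t t0 t1.
move: fu fv; rewrite !ltr_norml => /andP[? ?] /andP[? ?].
by apply/andP; split; nra.
Qed.

HB.instance Definition _ :=
  PreTopologicalNmodule_isTopologicalNmodule.Build Cp add_cts.

HB.instance Definition _ :=
  TopologicalNmodule_isTopologicalLmodule.Build R Cp scale_cts.

HB.instance Definition _ := Uniform_isTvs.Build R Cp locally_convex.

End Cp.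

Section Maps.
Context (R : realType) (E F : tvsType R).

(* Meant for a continuous linear T. *)
Definition polar (T : E -> F) : Prop :=
  exists U : set_system E,
    [/\ forall A, U A -> [/\ nbhs 0 A, closed A & closed (T @` A)]
      & forall V, nbhs (0 : E) V -> exists2 A, U A & A `<=` V].

Definition semi_embedding (T : {linear E -> F}) : Prop :=
  [/\ continuous T, polar T & injective T].

(* The left inverse S is a continuous inverse of T on its range, where it is
   linear because T is. *)
Definition embedding (T : {linear E -> F}) : Prop :=
  continuous T /\
  exists2 S : F -> E, cancel T S & {within range T, continuous S}.

Definition open_map (T : E -> F) : Prop :=
  forall U : set E, open U -> open (T @` U).

End Maps.

(* Main.v *)
From HB Require Import structures.
Require Import Defs.
From mathcomp Require Import all_boot all_order all_algebra.
From mathcomp Require Import all_classical all_reals all_analysis.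
From mathcomp Require Import lra ring.
Import Order.TTheory GRing.Theory Num.Theory.
Import numFieldNormedType.Exports.

(** Everything goes through one property of a linear map T from C_p(X) to
    C_p(Y), called [finitely_determined] below: for every x there is a finite
    set s of points of Y such that Tf = 0 on s forces f(x) = 0.  By
    linear algebra f(x) is then a fixed linear combination of the values of Tf
    on s, so T is injective and its inverse is continuous on the range.

    - A semi-embedding is finitely determined
      ([polar_finitely_determined]).  Polarity provides a neighbourhood U of 0
      with T(U) closed, small enough that |f(x)| < 1 on U.  It contains the
      subspace E of the functions vanishing on a finite set F, so the closure
      of T(E) lies in T(U).  The kernels of finitely many evaluations composed
      with T, restricted to F, decrease to a smallest subspace of the
      finite-dimensional space of functions on F; a finite set s of points of Y
      at which that minimum is reached is such that Tf lies in the closure of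
      T(E) as soon as Tf = 0 on s.  Then all multiples of f lie in U, and
      f(x) = 0.

    - A finitely determined continuous T with Y scattered forces X to be
      scattered ([finitely_determined_scattered]).  Countably many continuous
      functions on the scattered compact Y take, jointly, only countably many
      values ([scattered_countable_trace]), whereas a compact X that is not
      scattered carries a Cantor tree of open sets, hence a countable family of
      functions that no countable set of points exhausts
      ([nonscattered_diagonal]).  The images under T of that family only depend
      on countably many points of Y, each of which only sees finitely many
      points of X; a point x of X away from these contradicts
      finite determination.

    For the second assertion, X contains a sequence a_0, a_1, ... of distinct
    isolated points converging to some point, so that the map sigma which sends
    a_n to a_(n+1) and fixes all other points is continuous.  The operator
    Tf = f - (f o sigma) / 2 is bijective because its inverse is the Neumann
    series with terms (g o sigma^k) / 2^k, which converges uniformly.  But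
    f(a_0) is the sum of the Tf(a_k) / 2^k, in which no term can be dropped: T
    is not finitely determined.  Open injections and polar injections are
    finitely determined, so T is neither open nor a semi-embedding. *)

Set Implicit Arguments.
Unset Strict Implicit.
Unset Printing Implicit Defensive.

Local Open Scope classical_set_scope.
Local Open Scope ring_scope.

(** * Finitely determined maps *)

Lemma Cp_nbhs_agree (R : realType) (X : topologicalType) (h : Cp R X)
    (A : set (Cp R X)) : nbhs h A ->
  exists s : seq X, forall f : Cp R X, {in s, forall x, f x = h x} -> A f.
Proof.
pose agree (s : seq X) : set (Cp R X) := [set f | {in s, forall x, f x = h x}].
suff: filter_from [set: seq X] agree --> h by move=> Fh /Fh [s _ sA]; exists s.
have FF : Filter (filter_from [set: seq X] agree).
  apply: filter_from_filter => [|s t _ _]; first by exists [::].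
  exists (s ++ t) => // f fh.
  by split=> x xs; apply: fh; rewrite mem_cat xs ?orbT.
apply/Cp_cvgP => x B /nbhs_singleton Bhx.
by exists [:: x] => // f fh; rewrite /preimage /= fh ?inE.
Qed.

Section LinearFunctionals.
Context (R : realType) (V : lmodType R).

(** Induction on [s].  If [psi j] does not vanish on the common kernel of the
    other functionals, it takes a nonzero value at some vector [e] there, and
    subtracting from [ell] the multiple of [psi j] that kills [e] leaves a
    functional to which the induction hypothesis applies. *)
Lemma common_kernel_span (J : eqType) (psi : J -> {linear V -> R^o})
    (s : seq J) (ell : {linear V -> R^o}) :
  (forall v, {in s, forall j, psi j v = 0} -> ell v = 0) ->
  exists cs : seq (J * R), forall v, ell v = \sum_(p <- cs) p.2 * psi p.1 v.
Proof.
elim: s ell => [|j s IHs] ell ellP.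
  by exists [::] => v; rewrite big_nil ellP.
have [[e eker je0]|jker] :=
    pselect (exists2 e, {in s, forall i, psi i e = 0} & psi j e != 0); last first.
  apply: IHs => v vker; apply: ellP => i; rewrite inE => /predU1P[->|/vker//].
  by apply: contra_notP jker => /eqP jv; exists v.
pose a := ell e / psi j e.
have [|cs csE] := IHs (ell \- a \*: psi j).
  move=> v vker /=; pose b := psi j v / psi j e.
  have : ell (v - b *: e) = 0.
    apply: ellP => i; rewrite inE linearB linearZ /= /GRing.scale /= /b.
    by case/predU1P => [->|si]; [field|rewrite (vker _ si) (eker _ si); ring].
  rewrite linearB linearZ /= /GRing.scale /= /a /b => /eqP.
  by rewrite subr_eq0 => /eqP ->; field.
exists ((j, a) :: cs) => v; rewrite big_cons -csE /= /GRing.scale /=; ring.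
Qed.

(** The restrictions to [s] of the common kernels of finitely many [psi j] form
    a decreasing family of subspaces of a finite-dimensional space, so the
    family reaches its minimum at some [t].  Induction on [s] replaces the
    dimension count: for a new index [i], either some kernel [t1] already
    forces [phi i] to vanish once the previous [phi] do, or every kernel
    contains a vector that adjusts the value of [phi i] alone. *)
Lemma restriction_stabilises (I J : eqType) (phi : I -> {linear V -> R^o})
    (psi : J -> {linear V -> R^o}) (s : seq I) :
  exists t : seq J, forall (t' : seq J) (v : V),
    {in t, forall j, psi j v = 0} ->
    exists w, {in t', forall j, psi j w = 0} /\
              {in s, forall i, phi i w = phi i v}.
Proof.
elim: s => [|i s [t0 t0P]].
  by exists [::] => t' v _; exists 0; split=> // j _; rewrite linear0.
have [[t1 t1P]|noker] := pselect (exists t1 : seq J, forall w,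
    {in t1, forall j, psi j w = 0} -> {in s, forall k, phi k w = 0} ->
    phi i w = 0).
  exists (t1 ++ t0) => t' v vker.
  have [|w [wker wv]] := t0P (t1 ++ t') v.
    by move=> j jt; apply: vker; rewrite mem_cat jt orbT.
  exists w; split=> [j jt'|k]; first by apply: wker; rewrite mem_cat jt' orbT.
  rewrite inE => /predU1P[->|/wv//].
  apply/eqP; rewrite -subr_eq0 -linearB; apply/eqP; apply: t1P => [j jt|l ls].
    by rewrite linearB wker ?vker ?subrr// mem_cat jt.
  by rewrite linearB wv// subrr.
exists t0 => t' v vker; have [w [wker wv]] := t0P t' v vker.
have [u [uker us ui]] : exists u, [/\ {in t', forall j, psi j u = 0},
    {in s, forall k, phi k u = 0} & phi i u != 0].
  apply: contra_notP noker => nou; exists t' => u uker us.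
  by apply: contra_notP nou => /eqP ui; exists u.
exists (w + (phi i (v - w) / phi i u) *: u); split=> [j jt'|k].
  by rewrite linearD linearZ /= wker// uker// add0r; exact: mulr0.
rewrite inE linearD linearZ linearB /= /GRing.scale /= => /predU1P[->|ks].
  by field.
by rewrite (us _ ks) mulr0 addr0 wv.
Qed.

End LinearFunctionals.

(** Evaluation is given a name of its own so that it can carry the structure of
    a linear form. *)
Definition Cp_eval (R : realType) (X : topologicalType) (x : X)
    (f : Cp R X) : R^o := f x.

Lemma Cp_eval_linear (R : realType) (X : topologicalType) (x : X) :
  linear (@Cp_eval R X x).
Proof. by []. Qed.

HB.instance Definition _ (R : realType) (X : topologicalType) (x : X) :=
  GRing.isLinear.Build R (Cp R X) R^o _
    (@Cp_eval R X x) (@Cp_eval_linear R X x).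

Lemma CpBE (R : realType) (X : topologicalType) (f g : Cp R X) x :
  (f - g) x = f x - g x.
Proof. by []. Qed.

Definition finitely_determined (R : realType) (X Y : topologicalType)
    (T : Cp R X -> Cp R Y) :=
  forall x, exists s : seq Y, forall f,
    {in s, forall y, T f y = 0} -> f x = 0.

Lemma Cp_eval_lt1 (R : realType) (X : topologicalType) (x : X) :
  nbhs (0 : Cp R X) [set f | `|f x| < 1].
Proof.
have /cvgrPdist_lt/(_ 1 ltr01) := @Cp_eval_continuous R X x 0.
by apply: filterS => f /=; rewrite sub0r normrN.
Qed.

Lemma scaled_lt1_eq0 (R : realType) (a : R) :
  (forall t : R, `|t * a| < 1) -> a = 0.
Proof.
move=> small; apply/eqP; apply: contraT => a0.
by have := small a^-1; rewrite mulVf// normr1 ltxx.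
Qed.

Section CpMaps.
Context (R : realType) (X Y : topologicalType).
Implicit Types (T : {linear Cp R X -> Cp R Y}).

Lemma continuous_finite_support T : continuous T ->
  forall y, exists s : seq X, forall f : Cp R X,
    {in s, forall x, f x = 0} -> T f y = 0.
Proof.
move=> cT y; have /cT : nbhs (T 0) [set g | `|g y| < 1].
  by rewrite linear0; exact: Cp_eval_lt1.
move=> /Cp_nbhs_agree [s sP]; exists s => f fs.
apply: scaled_lt1_eq0 => t; rewrite -CpZE -linearZ; apply: sP => x xs.
by rewrite CpZE fs ?mulr0.
Qed.

(** If [T f] vanishes on the set [t] given by [restriction_stabilises], then
    every basic neighbourhood of [T (a *: f)], prescribing its values on some
    [t'], contains the image of [a *: f - g], where [g] agrees with [a *: f] on
    [s] and [T g] vanishes on [t'].  Hence [T (a *: f)] is in the closed set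
    [T @` U], for every scalar [a]. *)
Lemma polar_finitely_determined T :
  polar T -> injective T -> finitely_determined T.
Proof.
move=> [B [BP Bbase]] injT x.
have [U /BP [U0 _ clTU] Usub] := Bbase _ (Cp_eval_lt1 R x).
have [s sU] := Cp_nbhs_agree U0.
have [t tP] := restriction_stabilises (@Cp_eval R X)
  (fun y => (Cp_eval y \o T)) s.
exists t => f ft; apply: scaled_lt1_eq0 => a; rewrite -CpZE.
suff [u Uu /injT <-] : (T @` U) (T (a *: f)) by exact: Usub.
apply: clTU => A /Cp_nbhs_agree [t' t'A].
have [|g [gt' gs]] := tP t' (a *: f).
  by move=> y yt; rewrite /= linearZ /Cp_eval CpZE ft// mulr0.
exists (T (a *: f - g)); split.
  exists (a *: f - g) => //; apply: sU => z zs.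
  by have gz : g z = (a *: f) z := gs z zs; rewrite CpBE gz subrr.
apply: t'A => y yt'; rewrite linearB.
have gy : T g y = 0 := gt' y yt'.
by rewrite CpBE gy subr0.
Qed.

Lemma finitely_determined_injective T : finitely_determined T -> injective T.
Proof.
move=> fdT f g Tfg; apply: CpP => x; have [s sP] := fdT x.
apply/eqP; rewrite -subr_eq0; apply/eqP; apply: (sP (f - g)) => y _.
by rewrite linearB Tfg subrr.
Qed.

(** On the range of [T], evaluating the inverse at a point is a linear
    combination of evaluations by [common_kernel_span]. *)
Lemma finitely_determined_embedding T :
  continuous T -> finitely_determined T -> embedding T.
Proof.
move=> cT fdT; split=> //; have injT := finitely_determined_injective fdT.
pose S (g : Cp R Y) : Cp R X := xget 0 (T @^-1` [set g]).
have TK : cancel T S.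
  by move=> f; apply: injT; exact: (@xgetI _ 0 (T @^-1` [set T f]) f).
exists S => //; apply/subspace_continuousP => _ [f _ <-].
suff: S @ within (range T) (nbhs (T f)) --> f by rewrite -{2}[f]TK.
apply/Cp_cvgP => x.
have [s sP] := fdT x.
have [cs csE] := common_kernel_span (psi := fun y : Y => @Cp_eval R Y y \o T)
  (ell := @Cp_eval R X x) sP.
have {}csE (h : Cp R X) : h x = \sum_(p <- cs) p.2 * T h p.1 by exact: csE.
have cvg_sum : (fun g : Cp R Y => \sum_(p <- cs) p.2 * g p.1 : R) @ (nbhs (T f))
    --> (f x : R).
  rewrite csE; apply: cvg_big => [|p _].
    by move=> z; exact: (@add_continuous R).
  apply: cvgM; first exact: cvg_cst.
  exact: Cp_eval_continuous.
apply: (@cvg_trans _ ((fun g : Cp R Y => \sum_(p <- cs) p.2 * g p.1 : R)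
    @ within (range T) (nbhs (T f)))); last first.
  by apply: cvg_trans cvg_sum; apply: cvg_app; exact: cvg_within.
move=> B; apply: (@filterS _ (nbhs (T f)) _) => g BT Tg; move: (BT Tg).
by case: Tg => h _ <-; rewrite /= TK csE.
Qed.

End CpMaps.

(** * Countable families of functions on scattered compact spaces *)

(** Compactness as an induction principle for ideals of sets.  If [A] were not in
    the ideal, the sets [B] with [A `\` B] in the ideal would form a proper
    filter, and no neighbourhood of a cluster point of that filter in [A] could
    be in the ideal. *)
Lemma compact_ideal (T : topologicalType) (A : set T) (P : set T -> Prop) :
  compact A -> P set0 -> (forall B C, B `<=` C -> P C -> P B) ->
  (forall B C, P B -> P C -> P (B `|` C)) ->
  (forall x, A x -> exists2 N, nbhs x N & P N) -> P A.
Proof.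
move=> cA P0 PS PU Ploc; apply: contrapT => nPA.
pose F : set_system T := [set B | P (A `\` B)].
have FF : ProperFilter F.
  split; first by rewrite /F /= setD0.
  split=> [|B C FB FC|B C BC FB].
  - by rewrite /F /= setDT.
  - by rewrite /F /= setDIr; exact: PU.
  - by apply: PS FB; exact: setDS.
have FA : F A by rewrite /F /= setDv.
have [x [Ax xF]] := cA F FF FA.
have [N Nx PN] := Ploc x Ax.
have FN : F (~` N) by apply: PS PN; rewrite setDE setCK; exact: subIsetr.
by have [y [/=]] := xF _ _ FN Nx.
Qed.

Section CountableTraces.
Context (R : realType) (Y : topologicalType) (I : countType) (g : I -> Y -> R).

(** The image of [A] under the joint map [z |-> (g i z)_i] is countable; the
    witness [D] consists of representatives of the fibres. *)
Definition countable_trace (A : set Y) := exists2 D : set Y,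
  countable D & forall y, A y -> exists2 z, D z & forall i, g i z = g i y.

Lemma countable_traceS (A B : set Y) :
  A `<=` B -> countable_trace B -> countable_trace A.
Proof. by move=> AB [D cD DP]; exists D => // y /AB; exact: DP. Qed.

Lemma bigcup_countable_trace (J : choiceType) (K : set J) (F : J -> set Y) :
  countable K -> (forall j, K j -> countable_trace (F j)) ->
  countable_trace (\bigcup_(j in K) F j).
Proof.
move=> cK FP.
have /choice [D DP] : forall j, exists D : set Y, K j -> countable D /\
    forall y, F j y -> exists2 z, D z & forall i, g i z = g i y.
  move=> j; have [/FP[D cD DP]|nKj] := pselect (K j); first by exists D.
  by exists set0.
exists (\bigcup_(j in K) D j); first by apply: bigcup_countable => // j /DP[].
by move=> y [j Kj /(proj2 (DP _ Kj)) [z Dz zy]]; exists z => //; exists j.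
Qed.

Lemma compact_countable_trace (A : set Y) : compact A ->
  (forall y, A y -> exists2 N, nbhs y N & countable_trace N) ->
  countable_trace A.
Proof.
move=> cA; apply: compact_ideal => // [|B C|B C BP CP].
- by exists set0.
- exact: countable_traceS.
- apply: (@countable_traceS _ (\bigcup_(b in [set: bool]) if b then B else C)).
    by move=> y [By|Cy]; [exists true|exists false].
  by apply: bigcup_countable_trace => [|[]]; first exact: countableP.
Qed.

(** Let [W] be the set of points with a neighbourhood of countable trace.  If
    [W] were not the whole space, its complement would have an isolated point [y].
    In a small closed neighbourhood of [y], the points where some [g i] differs
    from [g i y] form a countable union of compact subsets of [W], the remaining
    ones are in the fibre of [y], and so [y] would be in [W]. *)
Lemma scattered_countable_trace : compact [set: Y] -> hausdorff_space Y ->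
  scattered Y -> (forall i, continuous (g i)) -> countable_trace [set: Y].
Proof.
move=> cY hY sY cg; pose W := [set y : Y | exists2 N, nbhs y N & countable_trace N].
suff noW : ~ ((~` W) !=set0).
  apply: compact_countable_trace => // y _.
  by apply: contrapT => nWy; apply: noW; exists y.
move=> /sY [y [/set_mem nWy [V Vy VW]]]; apply: nWy.
have [N Ny NV] := compact_regular hY cY filterT Vy.
pose far (p : I * nat) : set Y :=
  closure N `&` (fun z => `|g p.1 z - g p.1 y|) @^-1` [set t | p.2.+1%:R^-1 <= t].
have far_trace p : countable_trace (far p).
  apply: compact_countable_trace.
    apply: (subclosed_compact _ cY) => //; apply: closedI.
      exact: closed_closure.
    apply: preimage_closed; last exact: closed_ge.
    move=> z _; apply: (@cvg_norm R R _ (nbhs z) _ (fun z => g p.1 z - g p.1 y)).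
    apply: (@cvgB R R _ (nbhs z) _ (fun z => g p.1 z) (fun=> g p.1 y)).
      exact: cg.
    exact: cvg_cst.
  move=> z [/NV Vz gz]; apply: contrapT => nWz.
  have zy : [set y] z by rewrite -VW; split.
  by move: gz; rewrite zy /= subrr normr0 leNgt invr_gt0 ltr0Sn.
exists (closure N); first by apply: filterS Ny; exact: subset_closure.
pose near_y := [set z | forall i, g i z = g i y].
have near_trace : countable_trace near_y.
  by exists [set y] => // z zy; exists y => // i; rewrite zy.
apply: (@countable_traceS _ (\bigcup_(o in [set: option (I * nat)])
    oapp far near_y o)).
  move=> z Nz; have [zy|/existsNP[i gzy]] := pselect (near_y z).
    by exists None.
  have : 0 < `|g i z - g i y| by rewrite normr_gt0 subr_eq0; exact/eqP.
  move=> /ltr_add_invr [n]; rewrite add0r => /ltW gn.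
  by exists (Some (i, n)).
apply: bigcup_countable_trace => [|[p|] _]; first exact: countableP.
- exact: far_trace.
- exact: near_trace.
Qed.

End CountableTraces.

(** * Cantor trees in compact spaces that are not scattered *)

Lemma Cp_separating_bumps (R : realType) (X : topologicalType) (a b : X) :
  compact [set: X] -> hausdorff_space X -> a != b ->
  exists f : bool -> Cp R X,
    [/\ f false a = 1, f true b = 1 & forall x, exists i, f i x = 0].
Proof.
move=> cX hX ab.
have clx (x : X) : closed [set x].
  exact/accessible_closed_set1/hausdorff_accessible.
have [h [ch _ h0 h1]] : exists h : X -> R, [/\ continuous h, range h `<=` `[0, 1],
    h @` [set a] `<=` [set 0] & h @` [set b] `<=` [set 1]].
  apply/uniform_separatorP/normal_uniform_separator => //.
  - exact: compact_normal.
  - by apply/disjoints_subset => x -> /= /eqP; rewrite (negbTE ab).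
have ha : h a = 0 by apply: h0; exists a.
have hb : h b = 1 by apply: h1; exists b.
pose f (i : bool) x := Num.max 0 (if i then 2 * h x - 1 else 1 - 2 * h x).
have cf i : continuous (f i).
  move=> x; apply: (@continuous_max R X (fun=> 0)); first exact: cvg_cst.
  have c2 : (fun x => 2 * h x) @ x --> 2 * h x.
    by apply: (@cvgM R X); [exact: cvg_cst|exact: ch].
  case: i; apply: (@cvgB R R) => //; exact: cvg_cst.
exists (fun i => mkcts (cf i) : continuousType X R); split.
- by rewrite /= /mkcts /f ha mulr0 subr0; apply/max_idPr.
- by rewrite /= /mkcts /f hb (_ : 2 * 1 - 1 = 1); [apply/max_idPr|ring].
- move=> x; exists (h x <= 2^-1) => /=; rewrite /mkcts /f.
  by apply/max_idPl; case: ifPn => hx; lra.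
Qed.

(** Let [A] be nonempty without isolated points.  Every open set meeting [A]
    contains two points of [A], hence two bumps with disjoint supports, each of
    them large on an open set that still meets [A].  This yields a binary tree
    of open sets [U s] carrying the bumps [f (U s) i].  Given a countable [C],
    choose at the n-th step the branch whose bump vanishes at the n-th point of
    [C]; a point [x] in the closures of all sets along the branch sees all the
    chosen bumps. *)
Lemma nonscattered_diagonal (R : realType) (X : topologicalType) :
  compact [set: X] -> hausdorff_space X -> ~ scattered X ->
  exists d : seq bool * bool -> Cp R X, forall C : set X, countable C ->
    exists x, forall c, C c -> exists2 i, d i c = 0 & d i x != 0.
Proof.
move=> cX hX /existsNP[A /not_implyP[[a0 Aa0] isoA]].
have /choice [f fP] : forall O, exists f : bool -> Cp R X,
    open O -> O `&` A !=set0 ->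
    (forall x, exists i, f i x = 0) /\
    forall i, (O `&` [set x | 2^-1 < f i x] `&` A) !=set0.
  move=> O; have [[oO [a [Oa Aa]]]|nO] := pselect (open O /\ O `&` A !=set0);
    last by exists (fun=> 0) => oO OA; case: nO.
  have [b [Ob Ab] ab] : exists2 b, (O `&` A) b & a != b.
    apply: contra_notP isoA => nob; exists a; split; first exact/mem_set.
    exists O; first exact: open_nbhs_nbhs.
    apply/seteqP; split=> [b OAb|_ ->] //=.
    by apply: contra_notP nob => /eqP; rewrite eq_sym; exists b.
  have [g [ga gb g0]] := Cp_separating_bumps R cX hX ab.
  by exists g => _ _; split=> // -[]; [exists b|exists a]; split=> //; split=> //=;
    rewrite ?ga ?gb; lra.
pose U := foldr (fun i O => O `&` [set x | 2^-1 < f O i x]) [set: X].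
have UP s : open (U s) /\ U s `&` A !=set0.
  elim: s => [|i s [oU UA]]; first by split; [exact: openT|exists a0].
  split; last exact: (fP _ oU UA).2.
  apply: openI => //; apply: open_comp (@open_gt R 2^-1) => x _.
  exact: Cp_continuous.
exists (fun p => f (U p.1) p.2) => C /countable_injP[e injE].
(* the branch to follow at node s, so as to avoid the point of C numbered n *)
pose next n s := `[< exists c, [/\ C c, e c = n & f (U s) true c = 0] >].
pose s := fix s n := if n is m.+1 then next m (s m) :: s m else [::].
have sS n : U (s n.+1) = U (s n) `&` [set x | 2^-1 < f (U (s n)) (next n (s n)) x].
  by [].
have decr n m : (n <= m)%N -> U (s m) `<=` U (s n).
  move=> /subnKC <-; elim: (m - n)%N => [|k IHk]; first by rewrite addn0.
  by rewrite addnS sS => x [/IHk].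
have [x [_ xcl]] : [set: X] `&` cluster (filter_from [set: nat] (U \o s)) !=set0.
  apply: cX; last by exists 0%N.
  apply: filter_from_proper; last first.
    by move=> n _; have [_ [x [Ux _]]] := UP (s n); exists x.
  apply: filter_from_filter => [|n m _ _]; first by exists 0%N.
  exists (maxn n m) => // x Ux; split; apply: decr Ux.
    exact: leq_maxl.
  exact: leq_maxr.
have branch n : 2^-1 <= f (U (s n)) (next n (s n)) x.
  set h := f _ _; rewrite leNgt; apply/negP => hx.
  have FU : filter_from [set: nat] (U \o s) (U (s n.+1)) by exists n.+1.
  have nx : nbhs x [set z | h z < 2^-1].
    apply: open_nbhs_nbhs; split=> //; apply: open_comp (@open_lt R 2^-1) => z _.
    exact: Cp_continuous.
  have [z [[_ /= hz] /=]] := xcl _ _ FU nx.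
  by rewrite ltNge (ltW hz).
exists x => c Cc; exists (s (e c), next (e c) (s (e c))) => /=; last first.
  by rewrite gt_eqF// (lt_le_trans _ (branch _)).
have [oU UA] := UP (s (e c)); have [/(_ c)[i fi] _] := fP _ oU UA.
have [/asboolP[c' [Cc' ec' fc']]|/asboolPn nx] := boolP (next _ _).
  by move: fc'; rewrite (injE c' c) ?inE.
by case: i fi => // fi; case: nx; exists c.
Qed.

(** * Finitely determined maps into functions on a scattered space *)

Lemma prod_continuous (R : realType) (X : topologicalType) (I : Type)
    (d : I -> Cp R X) (l : seq I) :
  continuous (fun x => \prod_(i <- l) d i x).
Proof.
apply: continuous_big => [|i _]; last exact: Cp_continuous.
by move=> z; exact: (@mul_continuous R).
Qed.

Definition Cp_prod (R : realType) (X : topologicalType) (I : Type)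
    (d : I -> Cp R X) (l : seq I) : Cp R X :=
  (mkcts (@prod_continuous R X I d l) : continuousType X R).

(** Suppose [X] is not scattered and let [d] be the family of
    [nonscattered_diagonal].  The images under [T] of the finite products of
    [d] are determined by a countable [D]; let [x] be the point of the diagonal
    argument for the countable union of the supports of the points of [D].  If
    [s] determines [f x], move the points of [s] into [D]: a product [f] of
    bumps vanishing on their finitely many supports but not at [x] satisfies
    [T f = 0] on [s], a contradiction. *)
Lemma finitely_determined_scattered (R : realType) (X Y : topologicalType)
    (T : {linear Cp R X -> Cp R Y}) :
  compact [set: X] -> hausdorff_space X -> compact [set: Y] ->
  hausdorff_space Y -> scattered Y -> continuous T -> finitely_determined T ->
  scattered X.
Proof.
move=> cX hX cY hY sY cT fdT; apply: contrapT => nsX.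
have [d dP] := nonscattered_diagonal R cX hX nsX.
have [D cD DP] := scattered_countable_trace cY hY sY
  (fun l => @Cp_continuous R Y (T (Cp_prod d l))).
have /choice [supp suppP] := continuous_finite_support cT.
have [|x xP] := dP (\bigcup_(y in D) [set` supp y]).
  apply: bigcup_countable => // y _.
  exact/finite_set_countable/finite_seq.
have [s sP] := fdT x.
have /choice [z zP] : forall y, exists z, D z /\
    forall l, T (Cp_prod d l) z = T (Cp_prod d l) y.
  by move=> y; have [z Dz zy] := DP y I; exists z.
pose S := flatten [seq supp (z y) | y <- s].
have /choice [i iP] : forall c, exists i, c \in S -> d i c = 0 /\ d i x != 0.
  move=> c; have [cS|] := boolP (c \in S); last by exists ([::], true).
  have [|i dc dx] := xP c; last by exists i.
  have /flattenP[_ /mapP[y ys ->] cy] := cS.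
  by exists (z y) => //; exact: (zP y).1.
pose f := Cp_prod d [seq i c | c <- S].
have fx : f x != 0.
  rewrite /f /Cp_prod /= /mkcts big_map prodf_seq_neq0; apply/allP => c cS.
  exact: (iP c cS).2.
move/eqP: fx; apply; apply: sP => y ys.
rewrite -(zP y).2; apply: (suppP (z y)) => c cz.
rewrite /f /Cp_prod /= /mkcts big_map; apply/eqP.
rewrite prodf_seq_eq0; apply/hasP.
have cS : c \in S by apply/flattenP; exists (supp (z y)) => //; exact: map_f.
by exists c => //=; rewrite (iP c cS).1.
Qed.

(** The image of [`|f x| < 1] is a neighbourhood of 0, hence contains every
    function vanishing on some finite set. *)
Lemma open_finitely_determined (R : realType) (X Y : topologicalType)
    (T : {linear Cp R X -> Cp R Y}) :
  injective T -> open_map T -> finitely_determined T.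
Proof.
move=> injT oT x; pose U : set (Cp R X) := [set f | `|f x| < 1].
have oU : open U.
  apply: (@open_comp _ _ (fun f : Cp R X => `|f x|) [set t | t < 1]); last first.
    exact: open_lt.
  move=> f _; apply: (@cvg_norm R R _ (nbhs f) _ (fun h : Cp R X => h x)).
  exact: Cp_eval_continuous.
have /Cp_nbhs_agree [s sP] : nbhs (0 : Cp R Y) (T @` U).
  apply: open_nbhs_nbhs; split; first exact: oT.
  by exists 0; rewrite ?linear0 // /U /= normr0.
exists s => f fs; apply: scaled_lt1_eq0 => a; rewrite -CpZE.
suff [u Uu /injT <-] : (T @` U) (T (a *: f)) by [].
by apply: sP => y ys; rewrite linearZ CpZE fs// mulr0.
Qed.

(** * The operator f |-> f - (f o sigma) / 2 *)

Lemma Cp_bounded (R : realType) (X : topologicalType) (f : Cp R X) :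
  compact [set: X] -> exists M, forall x, `|f x| <= M.
Proof.
move=> cX; suff [M MP] : exists M, forall x, [set: X] x -> `|f x| <= M.
  by exists M => x; exact: MP.
apply: (compact_ideal (P := fun B => exists M, forall x, B x -> `|f x| <= M)) => //.
- by exists 0.
- by move=> B C BC [M MP]; exists M => x /BC; exact: MP.
- move=> B C [M MP] [N NP]; exists (Num.max M N) => x [/MP|/NP] fx.
    by rewrite le_max fx.
  by rewrite le_max fx orbT.
move=> x _; exists [set y | `|f x - f y| < 1].
  by move/cvgrPdist_lt : (@Cp_continuous R X f x) => /(_ 1 ltr01).
exists (`|f x| + 1) => y /= /ltW fxy.
rewrite -[f y](subKr (f x)) (le_trans (ler_normB _ _))//.
by rewrite lerD2l.
Qed.

Section IdSubHalfComp.
Context (R : realType) (X : topologicalType) (sigma : X -> X).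
Hypothesis csigma : continuous sigma.

Lemma comp_sigma_continuous (f : Cp R X) : continuous (fun x => f (sigma x)).
Proof.
by move=> x; apply: continuous_comp; [exact: csigma|exact: Cp_continuous].
Qed.

Definition Cp_comp (f : Cp R X) : Cp R X :=
  (mkcts (@comp_sigma_continuous f) : continuousType X R).

Definition id_sub_half_comp (f : Cp R X) : Cp R X := f - 2^-1 *: Cp_comp f.

Lemma id_sub_half_compE f x :
  id_sub_half_comp f x = f x - 2^-1 * f (sigma x).
Proof. by []. Qed.

Lemma id_sub_half_comp_linear : linear id_sub_half_comp.
Proof.
move=> a f g; apply: CpP => x.
transitivity ((a *: f + g) x - 2^-1 * (a *: f + g) (sigma x)) => //.
rewrite [RHS]CpDE CpZE !id_sub_half_compE !(CpDE, CpZE); ring.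
Qed.

HB.instance Definition _ := GRing.isLinear.Build R (Cp R X) (Cp R X) _
  id_sub_half_comp id_sub_half_comp_linear.

Lemma id_sub_half_comp_continuous : continuous id_sub_half_comp.
Proof.
move=> f; have FF : Filter (id_sub_half_comp @ nbhs f).
  exact: (fmap_filter _ (@nbhs_filter (Cp R X) f)).
apply/Cp_cvgP => x.
apply: (@cvgB R R _ (nbhs f) _ (fun g : Cp R X => g x)
  (fun g : Cp R X => 2^-1 * g (sigma x))).
  exact: Cp_eval_continuous.
apply: (@cvgM R _ (nbhs f) _ (fun=> 2^-1) (fun g : Cp R X => g (sigma x))).
  exact: cvg_cst.
exact: (@Cp_eval_continuous R X (sigma x) f).
Qed.

Hypothesis cX : compact [set: X].

(** If [f x = f (sigma x) / 2] everywhere, iterating gives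
    [`|f x| <= M / 2 ^ n] for all [n], where [M] bounds [f]. *)
Lemma id_sub_half_comp_inj : injective id_sub_half_comp.
Proof.
suff inj0 f : id_sub_half_comp f = 0 -> f = 0.
  move=> f g fg; apply/eqP; rewrite -subr_eq0; apply/eqP/inj0.
  by rewrite linearB /= fg subrr.
move=> f0; have [M MP] := Cp_bounded f cX.
have half x : f x = 2^-1 * f (sigma x).
  by apply/eqP; rewrite -subr_eq0 -id_sub_half_compE f0.
have small n x : `|f x| <= geometric M 2^-1 n.
  elim: n x => [|n IHn] x; first by rewrite /= expr0 mulr1.
  rewrite half normrM ger0_norm ?invr_ge0 //= exprS mulrCA.
  by rewrite ler_wpM2l ?invr_ge0 //; exact: IHn.
have half1 : `|2^-1 : R| < 1 by rewrite ger0_norm ?invr_ge0 //; lra.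
apply: CpP => x; apply/eqP; rewrite -normr_le0.
rewrite -(cvg_lim _ (cvg_geometric M half1)) //; apply: limr_ge.
  by apply/cvg_ex; exists 0; exact: cvg_geometric.
by apply: nearW => n; exact: small.
Qed.

(** The partial sums of the Neumann series for the inverse at [g], written in
    Horner form. *)
Fixpoint neumann_sum (g : Cp R X) (n : nat) : Cp R X :=
  if n is m.+1 then g + 2^-1 *: Cp_comp (neumann_sum g m) else 0.

Lemma neumann_sumS (g : Cp R X) n x :
  neumann_sum g n.+1 x = g x + 2^-1 * neumann_sum g n (sigma x).
Proof. by []. Qed.

Lemma neumann_sum_cauchy (g : Cp R X) (M : R) :
  (forall x, `|g x| <= M) -> forall n k x,
  `|neumann_sum g (n + k) x - neumann_sum g n x| <= geometric (2 * M) 2^-1 n.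
Proof.
move=> gM; elim=> [|n IHn] k x; last first.
  rewrite addSn !neumann_sumS opprD addrACA subrr add0r -mulrBr normrM.
  by rewrite ger0_norm ?invr_ge0 //= exprS mulrCA ler_wpM2l ?invr_ge0 //.
rewrite add0n /= expr0 mulr1 subr0.
elim: k x => [|k IHk] x.
  by rewrite normr0 mulr_ge0 // (le_trans _ (gM x)).
rewrite neumann_sumS (le_trans (ler_normD _ _))// normrM ger0_norm ?invr_ge0 //.
by have := gM x; have := IHk (sigma x); lra.
Qed.

(** The uniform limit of the partial sums is continuous and solves
    [f = g + (f o sigma) / 2]. *)
Lemma id_sub_half_comp_surj : range id_sub_half_comp = [set: Cp R X].
Proof.
apply/seteqP; split=> // g _.
have [M gM] := Cp_bounded g cX; have cauchy := neumann_sum_cauchy gM.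
have half1 : `|2^-1 : R| < 1 by rewrite ger0_norm ?invr_ge0 //; lra.
have small e : 0 < e -> exists n, geometric (2 * M) 2^-1 n < e.
  move=> e0; have /cvgrPdist_lt/(_ e e0) := cvg_geometric (2 * M) half1.
  case=> n _ /(_ n (leqnn n)) /=; rewrite sub0r normrN => /(le_lt_trans (ler_norm _)).
  by exists n.
have cvg_sum x : cvg (neumann_sum g n x @[n --> \oo]).
  apply: cauchy_cvg; apply/cauchy_exP => e e0; have [n nP] := small e e0.
  exists (neumann_sum g n x); exists n => // m /= /subnKC <-.
  by rewrite /ball /= distrC (le_lt_trans (cauchy _ _ _)).
pose f x : R := lim (neumann_sum g n x @[n --> \oo]).
have f_near n x : `|f x - neumann_sum g n x| <= geometric (2 * M) 2^-1 n.
  have cvgd : `|neumann_sum g m x - neumann_sum g n x| @[m --> \oo] -->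
      `|f x - neumann_sum g n x|.
    by apply: cvg_norm; apply: cvgB; [exact: cvg_sum|exact: cvg_cst].
  rewrite -(cvg_lim _ cvgd) //; apply: limr_le.
    by apply/cvg_ex; eexists; exact: cvgd.
  by exists n => // m /= /subnKC <-; exact: cauchy.
have cf : continuous f.
  move=> x; apply/cvgrPdist_lt => e e0.
  have [|n nP] := small (e / 3); first by rewrite divr_gt0.
  have /cvgrPdist_lt/(_ (e / 3)) := @Cp_continuous R X (neumann_sum g n) x.
  rewrite divr_gt0 // => /(_ isT); apply: filterS => y xy.
  have := f_near n x; have := f_near n y; move: xy nP.
  rewrite !ltr_norml !ler_norml => /andP[? ?] ? /andP[? ?] /andP[? ?].
  by apply/andP; split; lra.
exists (mkcts cf : continuousType X R) => //; apply: CpP => x.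
rewrite id_sub_half_compE /= /mkcts.
suff -> : f x = g x + 2^-1 * f (sigma x) by rewrite addrK.
apply: cvg_lim => //; rewrite -(cvg_shiftS (fun n => neumann_sum g n x)).
apply: (@cvgD R R); first exact: cvg_cst.
apply: (@cvgM R); [exact: cvg_cst|exact: cvg_sum].
Qed.

End IdSubHalfComp.

(** * Sequences of isolated points and the shift *)

Lemma finite_set_eventually (A : set nat) :
  finite_set A -> \forall n \near \oo, ~ A n.
Proof.
move=> /finite_seqP[s ->]; exists (\max_(i <- s) i).+1 => // n /= sn ns.
by move: sn; rewrite ltnNge leq_bigmax_seq.
Qed.

Section IsolatedSequences.
Context (X : topologicalType).
Hypotheses (cX : compact [set: X]) (hX : hausdorff_space X).

Lemma compact_isolated_finite (A : set X) :
  compact A -> (forall x, A x -> open [set x]) -> finite_set A.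
Proof.
move=> cA iA; apply: compact_ideal => // [|B C|x Ax].
- by move=> B C BC fC; exact: sub_finite_set fC.
- by rewrite finite_setU => *; split.
- exists [set x]; last exact: finite_set1.
  by apply: open_nbhs_nbhs; split=> //; exact: iA.
Qed.

(** Let [p] be isolated in the set of non-isolated points, and [N] a
    neighbourhood of [p] whose closure contains no other such point.  [N] is
    infinite since [p] is not isolated, and away from any neighbourhood of [p]
    the closure of [N] is compact and consists of isolated points, hence finite:
    any sequence of distinct points of [N] converges to [p]. *)
Lemma scattered_isolated_sequence : infinite_set [set: X] -> scattered X ->
  exists (a : nat -> X) (p : X),
    [/\ injective a, forall n, open [set a n] & a n @[n --> \oo] --> p].
Proof.
move=> infX sX; pose X' := [set x : X | ~ open [set x]].
have /sX [p [/set_mem X'p [V Vp VX']]] : X' !=set0.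
  apply: contra_notP infX => noX'; apply: compact_isolated_finite => // x _.
  by apply: contrapT => nox; apply: noX'; exists x.
have [N Np NV] := compact_regular hX cX filterT Vp.
have closed1 (x : X) : closed [set x].
  exact/accessible_closed_set1/hausdorff_accessible.
have isoN x : closure N x -> x <> p -> open [set x].
  move=> /NV Vx xp; apply: contrapT => X'x; apply: xp.
  have : (V `&` X') x by split.
  by rewrite VX'.
have infN : infinite_set (N `\ p).
  move=> finN; apply: X'p.
  have -> : [set p] = N^° `\` (N `\ p).
    apply/seteqP; split=> [_ ->|x [/interior_subset Nx Nxp]].
      by split=> [|[_ /(_ erefl)]//]; exact: Np.
    by apply: contrapT => xp; apply: Nxp.
  rewrite setDE; apply: openI; first exact: open_interior.
  apply/closed_openC; move: finN.
  exact: (iffLR (@accessible_finite_set_closed X) (hausdorff_accessible hX)).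
have [a ainj aN] : exists2 a : nat -> X, injective a & forall n, (N `\ p) (a n).
  have /infiniteP/card_leP/injfunPex[f _ finj] := infN.
  pose k (n : nat) : [set: nat] := SigSub (mem_set (I : [set: nat] n)).
  exists (fun n => val (f (k n))) => [n m /val_inj fnm|n].
    by have /(congr1 val) := finj _ _ (mem_set I) (mem_set I) fnm.
  exact: set_valP.
have iso n : open [set a n].
  by have [Na pa] := aN n; apply: isoN => //; exact: subset_closure.
exists a, p; split=> // W.
rewrite nbhsE => -[G [oG Gp] GW].
have finG : finite_set (a @^-1` (closure N `\` G)).
  apply: finite_preimage; first by move=> n m _ _; exact: ainj.
  apply: compact_isolated_finite.
    apply: (subclosed_compact _ cX) => //; rewrite setDE; apply: closedI.
      exact: closed_closure.
    exact: open_closedC.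
  by move=> x [Nx nGx]; apply: isoN => // xp; apply: nGx; rewrite xp.
apply: filterS (finite_set_eventually finG) => n nG; apply: GW.
apply: contrapT => nGa; apply: nG; split=> //.
by have [Na _] := aN n; exact: subset_closure.
Qed.

End IsolatedSequences.

Section Shift.
Context (X : topologicalType) (a : nat -> X) (p : X).
Hypotheses (hX : hausdorff_space X) (ainj : injective a)
  (aiso : forall n, open [set a n]) (ap : a n @[n --> \oo] --> p).

(** Continuity is only at stake at a point [x] off the sequence.  There it
    suffices that [a n] close to [x] implies [a n.+1] in the given neighbourhood
    of [x] for large [n]: this follows from convergence if [x = p], and
    otherwise holds because [a n] stays away from [x]. *)
Lemma isolated_sequence_shift : exists sigma : X -> X,
  [/\ continuous sigma, forall n, sigma (a n) = a n.+1
    & forall x, ~ range a x -> sigma x = x].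
Proof.
have /choice [sigma sP] : forall x, exists y,
    (forall n, x = a n -> y = a n.+1) /\ (~ range a x -> y = x).
  move=> x; have [[n _ <-]|nax] := pselect (range a x).
    by exists (a n.+1); split=> [m /ainj ->//|[]]; exists n.
  by exists x; split=> // n xn; case: nax; exists n.
have sa n : sigma (a n) = a n.+1 by exact: (sP _).1.
have sx x : ~ range a x -> sigma x = x by exact: (sP _).2.
exists sigma; split=> // x V Vx.
have [[n _ anx]|nax] := pselect (range a x).
  apply: (@filterS _ (nbhs x) _ [set x]) => [_ ->|].
    exact: nbhs_singleton Vx.
  by apply: open_nbhs_nbhs; split=> //; rewrite -anx; exact: aiso.
have {}Vx : nbhs x V by move: Vx; rewrite sx.
have [N Nx [m _ mP]] : exists2 N, nbhs x N &
    \forall n \near \oo, N (a n) -> V (a n.+1).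
  have [xp|xp] := eqVneq x p.
    exists setT; first exact: filterT.
    have /ap [m _ mP] : nbhs p V by rewrite -xp.
    by exists m => // n nm _; apply: mP; exact: leqW.
  move: hX; rewrite open_hausdorff => /(_ _ _ xp)[[A B] /= [xA pB] [oA oB AB]].
  exists A; first by apply: open_nbhs_nbhs; split=> //; exact: set_mem.
  have /ap [m _ mB] : nbhs p B by apply: open_nbhs_nbhs; split=> //; exact: set_mem.
  exists m => // n nm An; have : (A `&` B) (a n) by split=> //; exact: mB.
  by move/eqP: AB => ->.
pose early := a @` [set n | (n < m)%N].
have Ex : nbhs x (~` early).
  apply: open_nbhs_nbhs; split; last by move=> [n _ anx]; apply: nax; exists n.
  apply: closed_openC.
  apply: (iffLR (@accessible_finite_set_closed X) (hausdorff_accessible hX)).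
  exact/finite_image/finite_II.
apply: (@filterS _ (nbhs x)) (filterI Vx (filterI Nx Ex)) => y [Vy [Ny nEy]].
rewrite /preimage /=; have [[n _ any]|nay] := pselect (range a y).
  rewrite -any sa; apply: (mP n); last by rewrite any.
  by rewrite /= leqNgt; apply/negP => nm; apply: nEy; exists n.
by rewrite sx.
Qed.

End Shift.

Lemma isolated_indicator_continuous (R : realType) (X : topologicalType)
    (x : X) : hausdorff_space X -> open [set x] ->
  continuous (fun y => (y == x)%:R : R).
Proof.
move=> hX ox y; apply: cvg_near_cst; have [->|yx] := eqVneq y x.
  apply: (@filterS _ (nbhs x) _ [set x]) => [_ ->|]; first by rewrite eqxx.
  exact: open_nbhs_nbhs.
apply: (@filterS _ (nbhs y) _ (~` [set x])) => [z /eqP/negbTE -> //|].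
apply: open_nbhs_nbhs; split; last exact/eqP.
by apply: closed_openC; exact/accessible_closed_set1/hausdorff_accessible.
Qed.

Section Orbit.
Context (R : realType) (X : topologicalType) (a : nat -> X) (sigma : X -> X).
Hypotheses (hX : hausdorff_space X) (ainj : injective a)
  (aiso : forall n, open [set a n]) (csigma : continuous sigma)
  (sa : forall n, sigma (a n) = a n.+1)
  (sx : forall x, ~ range a x -> sigma x = x).

Definition spike n : Cp R X :=
  (mkcts (@isolated_indicator_continuous R X (a n) hX (aiso n))
    : continuousType X R).

(** The function with value [2 ^ j] at [a j] for [j <= n], and 0 elsewhere: its
    image under the operator telescopes to a single spike at [a n]. *)
Fixpoint spike_sum n : Cp R X :=
  if n is m.+1 then spike_sum m + 2 ^+ n *: spike n else spike 0.

Lemma spike_sigma n x :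
  spike n (sigma x) = if n is m.+1 then spike m x else 0.
Proof.
rewrite /spike /= /mkcts.
have [[m _ <-]|nax] := pselect (range a x).
  by rewrite sa; case: n => [|n]; rewrite !(inj_eq ainj).
have nx m : (x == a m) = false.
  by apply/negbTE/eqP => xm; apply: nax; exists m.
by rewrite sx // nx; case: n => [//|n]; rewrite nx.
Qed.

Lemma id_sub_half_comp_spike_sum n :
  id_sub_half_comp csigma (spike_sum n) = 2 ^+ n *: spike n.
Proof.
elim: n => [|n IHn]; apply: CpP => x.
  by rewrite id_sub_half_compE CpZE spike_sigma mulr0 subr0 expr0 mul1r.
have := congr1 (fun f : Cp R X => f x) IHn.
rewrite id_sub_half_compE CpZE => IHx.
rewrite id_sub_half_compE /= !CpDE !CpZE spike_sigma.
by move: IHx; rewrite exprS; set b := 2 ^+ n; set c := spike n x; lra.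
Qed.

Lemma spike_sum0 n : spike_sum n (a 0%N) = 1.
Proof.
elim: n => [|n IHn] /=; first by rewrite /mkcts eqxx.
by rewrite CpDE IHn CpZE /spike /= /mkcts (inj_eq ainj) /= mulr0 addr0.
Qed.

(** A finite set misses [a n] for large [n], and the image of [spike_sum n]
    vanishes there although [spike_sum n] is 1 at [a 0]. *)
Lemma id_sub_half_comp_not_determined :
  ~ finitely_determined (id_sub_half_comp (R := R) csigma).
Proof.
move=> /(_ (a 0%N)) [s sP].
have [n _ ns] : \forall n \near \oo, ~ (a @^-1` [set` s]) n.
  apply: finite_set_eventually; apply: finite_preimage; last exact: finite_seq.
  by move=> i j _ _; exact: ainj.
have /eqP : spike_sum n (a 0%N) = 0.
  apply: sP => y ys; rewrite id_sub_half_comp_spike_sum CpZE /spike /= /mkcts.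
  case: eqP => [yn|_]; last by rewrite mulr0.
  by case: (ns n (leqnn n)); rewrite /preimage /= -yn.
by rewrite spike_sum0 oner_eq0.
Qed.

End Orbit.

(** * Semi-embeddings and embeddings between function spaces *)

Theorem proposition11 (R : realType) (X Y : topologicalType)
    (compactX : compact [set: X]) (hausdorffX : hausdorff_space X)
    (compactY : compact [set: Y]) (hausdorffY : hausdorff_space Y)
    (scatteredY : scattered Y) :
  (eberlein R X ->
     forall T : {linear Cp R X -> Cp R Y},
       semi_embedding T -> (embedding T <-> scattered X)) /\
  (infinite_set [set: X] -> scattered X ->
     exists T : {linear Cp R X -> Cp R X},
       [/\ continuous T, injective T, range T = [set: Cp R X],
           ~ open_map T
         & eberlein R X -> ~ semi_embedding T]).
Proof.
split=> [_ T [cT pT iT]|infX sX].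
  have fdT := polar_finitely_determined pT iT.
  split=> _; first exact: finitely_determined_scattered fdT.
  exact: finitely_determined_embedding.
have [a [p [ainj aiso ap]]] :=
  scattered_isolated_sequence compactX hausdorffX infX sX.
have [sigma [csigma sa sx]] := isolated_sequence_shift hausdorffX ainj aiso ap.
have ndT := @id_sub_half_comp_not_determined R X a sigma hausdorffX ainj aiso
  csigma sa sx.
have injT := @id_sub_half_comp_inj R X sigma csigma compactX.
exists (id_sub_half_comp csigma); split=> //.
- exact: id_sub_half_comp_continuous.
- exact: id_sub_half_comp_surj.
- by move=> oT; exact/ndT/open_finitely_determined.
- by move=> _ [_ pT _]; exact/ndT/polar_finitely_determined.
Qed.
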